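(* Let $(E,d)$ be a $d$-$\sigma$-stable $L^0$-complete $RM$ space with base $(\Omega,\mathcal{F},P)$, let $\varepsilon\in L^0_{++}(\mathcal{F})$, and let $f:E\to\bar{L}^0(\mathcal{F})$ be proper, $\sigma$-stable, $\mathcal{T}_c$-lower semicontinuous and bounded from below. Then for any given point $x_0\in E$ satisfying $f(x_0)\le \bigwedge f(E)+\varepsilon$ and any given $\alpha\in L^0_{++}(\mathcal{F})$, there exists $z\in E$ such that the following hold: (1) $f(z)\le f(x_0)-\alpha\cdot d(z,x_0)$; (2) $d(z,x_0)\le \alpha^{-1}\cdot\varepsilon$; (3) for each $x\in E$ with $x\ne z$, one has $f(x)\ge f(z)-\alpha\cdot d(x,z)$ and $f(x)\neq f(z)-\alpha\cdot d(x,z)$.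
   Context: $(\Omega,\mathcal{F},P)$ is a probability space. $L^0(\mathcal{F})$ (resp. $\bar{L}^0(\mathcal{F})$) is the set of equivalence classes (under a.s. equality) of real-valued (resp. extended real-valued) $\mathcal{F}$-measurable random variables, ordered by $\xi\le\eta$ iff $\xi^0\le\eta^0$ a.s. for representatives $\xi^0,\eta^0$. $\bar{L}^0(\mathcal{F})$ is a complete lattice; $\bigwedge H$ and $\bigvee H$ denote infimum and supremum, and $f(E)=\{f(x):x\in E\}$. For $A\in\mathcal{F}$, ''$\xi>\eta$ on $A$'' means $\xi^0>\eta^0$ a.s. on $A$, and $\tilde{I}_A$ is the equivalence class of the characteristic function of $A$. $L^0_+(\mathcal{F})=\{\xi\in L^0(\mathcal{F}):\xi\ge 0\}$, $L^0_{++}(\mathcal{F})=\{\xi\in L^0(\mathcal{F}):\xi>0\text{ on }\Omega\}$. Products with $\tilde I_A$ use the convention $0\cdot(\pm\infty)=0$. An $RM$ (random metric) space with base $(\Omega,\mathcal{F},P)$ is a pair $(E,d)$, $E$ a nonempty set and $d:E\times E\to L^0_+(\mathcal{F})$, such that $d(p,q)=0$ iff $p=q$, $d(p,q)=d(q,p)$, and $d(p,r)\le d(p,q)+d(q,r)$. $L^0(\mathcal{F})$ is itself an $RM$ space under $|\xi-\eta|$, and $E\times L^0(\mathcal{F})$ is an $RM$ space under $d(x,y)+|r-s|$ for $(x,r),(y,s)$. A countable partition $\{A_n:n\in N\}$ of $\Omega$ to $\mathcal{F}$ is a sequence of pairwise disjoint members of $\mathcal{F}$ with union $\Omega$. $E$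 is $d$-$\sigma$-stable if for each sequence $\{x_n\}$ in $E$ and each countable partition $\{A_n\}$ of $\Omega$ to $\mathcal{F}$ there is $x\in E$ with $\tilde{I}_{A_n}\cdot d(x,x_n)=0$ for all $n$; such $x$ is unique and is denoted $\sum_{n=1}^\infty\tilde{I}_{A_n}\cdot x_n$. The $L^0$-uniformity on an $RM$ space $(E,d)$ has as base the sets $\{(x,y)\in E\times E: d(x,y)\le\varepsilon\}$ for $\varepsilon\in L^0_{++}(\mathcal{F})$; its topology is $\mathcal{T}_c$ (the $L^0$-topology); $(E,d)$ is $L^0$-complete if it is complete in this uniformity. For $f:E\to\bar{L}^0(\mathcal{F})$: $f$ is proper if $f(x)>-\infty$ on $\Omega$ for all $x\in E$ and $\{x\in E:f(x)<+\infty\text{ on }\Omega\}\ne\emptyset$; a proper $f$ is $\mathcal{T}_c$-lower semicontinuous if $\mathrm{epi}(f)=\{(x,r)\in E\times L^0(\mathcal{F}):f(x)\le r\}$ is $\mathcal{T}_c$-closed in $E\times L^0(\mathcal{F})$; $f$ is $\sigma$-stable if $f(\sum_{n}\tilde{I}_{A_n}\cdot x_n)=\sum_{n}\tilde{I}_{A_n}\cdot f(x_n)$ for all sequences $\{x_n\}$ in $E$ and all countable partitions $\{A_n\}$ of $\Omega$ to $\mathcal{F}$; $f$ is bounded from below if there is $\eta\in L^0(\mathcal{F})$ with $f(x)\ge\eta$ for all $x\in E$. *)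

(* Defs.v *)
From HB Require Import structures.
From mathcomp Require Import all_boot all_order all_algebra.
From mathcomp Require Import all_classical all_reals all_analysis.
From mathcomp Require Import measurable_realfun.

Set Implicit Arguments.
Unset Strict Implicit.
Unset Printing Implicit Defensive.

Import Order.TTheory GRing.Theory Num.Theory.
Import numFieldNormedType.Exports.

Local Open Scope classical_set_scope.
Local Open Scope quotient_scope.
Local Open Scope ring_scope.

Section aeEqMfun_facts.
Context d d' (R : realType) (T : measurableType d) (U : measurableType d').
Variable mu : {measure set T -> \bar R}.

Lemma aeEq_eqP (x y : {mfun_ mu, T >-> U}) :
  x = y <-> {ae mu, forall w, x w = y w}.
Proof.
split=> [->|xy]; first exact: aeW.
rewrite -[x]reprK -[y]reprK; apply/eqquotP/asboolP.
by apply: filterS xy => w xyw _.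
Qed.

Lemma aeEq_piE (f : {mfun T >-> U}) :
  {ae mu, forall w, (\pi_({mfun_ mu, T >-> U}) f : {mfun_ mu, T >-> U}) w = f w}.
Proof.
have /eqquotP/asboolP := reprK (\pi_({mfun_ mu, T >-> U}) f).
by apply: filterS => w /(_ I).
Qed.

End aeEqMfun_facts.

Section pack_mfun.
Context d d' (T : measurableType d) (U : measurableType d').
Variables (f : T -> U) (mf : measurable_fun [set: T] f).

Definition pack_mfun : {mfun T >-> U} :=
  HB.pack f (isMeasurableFun.Build _ _ _ _ f mf).

Lemma pack_mfunE : pack_mfun = f :> (T -> U). Proof. by []. Qed.

End pack_mfun.

Section measurable_facts.
Context d (T : measurableType d) (R : realType).

Lemma measurable_invr : measurable_fun [set: R] (@GRing.inv R).
Proof.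
rewrite (_ : [set: R] = [set 0] `|` ~` [set 0]); last by rewrite setUv.
have m0 : measurable [set 0 : R] by [].
apply/measurable_funU => //; first exact: measurableC.
split; first exact: measurable_fun_set1.
apply: open_continuous_measurable_fun.
  exact/closed_openC/closed_eq.
by move=> x; rewrite inE/= => /eqP x0; exact: inv_continuous.
Qed.

Lemma measurable_normr_mfun (f : {mfun T >-> R}) :
  measurable_fun [set: T] (fun w => `|f w|).
Proof. exact: measurableT_comp. Qed.

Lemma measurable_invr_mfun (f : {mfun T >-> R}) :
  measurable_fun [set: T] (fun w => (f w)^-1).
Proof. exact: (measurableT_comp measurable_invr). Qed.

Lemma measurable_EFin_mfun (f : {mfun T >-> R}) :
  measurable_fun [set: T] (fun w => (f w)%:E).
Proof. exact/measurable_EFinP. Qed.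

Lemma measurable_adde_mfun (f g : {mfun T >-> \bar R}) :
  measurable_fun [set: T] (fun w => f w + g w)%E.
Proof. exact: emeasurable_funD. Qed.

End measurable_facts.

Section L0.
Context d (T : measurableType d) (R : realType).
Variable P : probability T R.

(* classes, under a.s. equality, of real-valued random variables *)
Definition L0 : Type := {mfun_ P, T >-> R}.
(* classes, under a.s. equality, of extended real-valued random variables *)
Definition eL0 : Type := {mfun_ P, T >-> \bar R}.

HB.instance Definition _ := Choice.on L0.
HB.instance Definition _ := EqQuotient.on L0.
HB.instance Definition _ := Choice.on eL0.
HB.instance Definition _ := EqQuotient.on eL0.

Definition L0_fun (x : L0) : {mfun T >-> R} := repr x.
Coercion L0_fun : L0 >-> MeasurableFun.type.
Definition eL0_fun (x : eL0) : {mfun T >-> \bar R} := repr x.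
Coercion eL0_fun : eL0 >-> MeasurableFun.type.

Lemma L0_eqP (x y : L0) : x = y <-> {ae P, forall w, x w = y w}.
Proof. exact: aeEq_eqP. Qed.

Lemma L0_piE (f : {mfun T >-> R}) :
  {ae P, forall w, (\pi_L0 f : L0) w = f w}.
Proof. exact: aeEq_piE. Qed.

Lemma eL0_eqP (x y : eL0) : x = y <-> {ae P, forall w, x w = y w}.
Proof. exact: aeEq_eqP. Qed.

Lemma eL0_piE (f : {mfun T >-> \bar R}) :
  {ae P, forall w, (\pi_eL0 f : eL0) w = f w}.
Proof. exact: aeEq_piE. Qed.

Definition L0_le (x y : L0) : bool := `[< {ae P, forall w, x w <= y w} >].

Fact L0_le_refl : reflexive L0_le.
Proof. by move=> x; apply/asboolP; exact: aeW. Qed.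

Fact L0_le_anti : antisymmetric L0_le.
Proof.
move=> x y /andP[/asboolP xy /asboolP yx]; apply/L0_eqP.
by apply: filterS2 xy yx => w xy yx; apply/eqP; rewrite eq_le xy.
Qed.

Fact L0_le_trans : transitive L0_le.
Proof.
move=> y x z /asboolP xy /asboolP yz; apply/asboolP.
by apply: filterS2 xy yz => w; exact: le_trans.
Qed.

HB.instance Definition _ := Order.Le_isPOrder.Build ring_display L0
  L0_le_refl L0_le_anti L0_le_trans.

Lemma L0_leP (x y : L0) : x <= y <-> {ae P, forall w, x w <= y w}.
Proof. by split=> /asboolP. Qed.

Definition eL0_le (x y : eL0) : bool :=
  `[< {ae P, forall w, (x w <= y w)%E} >].

Fact eL0_le_refl : reflexive eL0_le.
Proof. by move=> x; apply/asboolP; exact: aeW. Qed.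

Fact eL0_le_anti : antisymmetric eL0_le.
Proof.
move=> x y /andP[/asboolP xy /asboolP yx]; apply/eL0_eqP.
by apply: filterS2 xy yx => w xy yx; apply/eqP; rewrite eq_le xy.
Qed.

Fact eL0_le_trans : transitive eL0_le.
Proof.
move=> y x z /asboolP xy /asboolP yz; apply/asboolP.
by apply: filterS2 xy yz => w; exact: le_trans.
Qed.

HB.instance Definition _ := Order.Le_isPOrder.Build ring_display eL0
  eL0_le_refl eL0_le_anti eL0_le_trans.

Lemma eL0_leP (x y : eL0) : x <= y <-> {ae P, forall w, (x w <= y w)%E}.
Proof. by split=> /asboolP. Qed.

Definition L0_zero : L0 := \pi_L0 (0 : {mfun T >-> R}).
Definition L0_one : L0 := \pi_L0 (1 : {mfun T >-> R}).
Definition L0_add (x y : L0) : L0 := \pi_L0 ((repr x : {mfun T >-> R}) + repr y).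
Definition L0_opp (x : L0) : L0 := \pi_L0 (- (repr x : {mfun T >-> R})).
Definition L0_mul (x y : L0) : L0 := \pi_L0 ((repr x : {mfun T >-> R}) * repr y).

Fact L0_zeroE : {ae P, forall w, L0_zero w = 0}. Proof. exact: L0_piE. Qed.
Fact L0_oneE : {ae P, forall w, L0_one w = 1}. Proof. exact: L0_piE. Qed.
Fact L0_addE x y : {ae P, forall w, L0_add x y w = x w + y w}.
Proof. exact: L0_piE. Qed.
Fact L0_oppE x : {ae P, forall w, L0_opp x w = - x w}.
Proof. exact: L0_piE. Qed.
Fact L0_mulE x y : {ae P, forall w, L0_mul x y w = x w * y w}.
Proof. exact: L0_piE. Qed.

Fact L0_addA : associative L0_add.
Proof.
move=> x y z; apply/L0_eqP.
near=> w.
rewrite (near (L0_addE x (L0_add y z)) w)// (near (L0_addE y z) w)//.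
by rewrite (near (L0_addE (L0_add x y) z) w)// (near (L0_addE x y) w)// addrA.
Unshelve. all: by end_near. Qed.

Fact L0_addC : commutative L0_add.
Proof.
move=> x y; apply/L0_eqP; near=> w.
by rewrite (near (L0_addE x y) w)// (near (L0_addE y x) w)// addrC.
Unshelve. all: by end_near. Qed.

Fact L0_add0r : left_id L0_zero L0_add.
Proof.
move=> x; apply/L0_eqP; near=> w.
by rewrite (near (L0_addE _ x) w)// (near L0_zeroE w)// add0r.
Unshelve. all: by end_near. Qed.

Fact L0_addNr : left_inverse L0_zero L0_opp L0_add.
Proof.
move=> x; apply/L0_eqP; near=> w.
by rewrite (near (L0_addE _ x) w)// (near (L0_oppE x) w)// (near L0_zeroE w)// addNr.
Unshelve. all: by end_near. Qed.

HB.instance Definition _ := GRing.isZmodule.Build L0 L0_addA L0_addC L0_add0r L0_addNr.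

Fact L0_mulA : associative L0_mul.
Proof.
move=> x y z; apply/L0_eqP; near=> w.
rewrite (near (L0_mulE x (L0_mul y z)) w)// (near (L0_mulE y z) w)//.
by rewrite (near (L0_mulE (L0_mul x y) z) w)// (near (L0_mulE x y) w)// mulrA.
Unshelve. all: by end_near. Qed.

Fact L0_mulC : commutative L0_mul.
Proof.
move=> x y; apply/L0_eqP; near=> w.
by rewrite (near (L0_mulE x y) w)// (near (L0_mulE y x) w)// mulrC.
Unshelve. all: by end_near. Qed.

Fact L0_mul1r : left_id L0_one L0_mul.
Proof.
move=> x; apply/L0_eqP; near=> w.
by rewrite (near (L0_mulE _ x) w)// (near L0_oneE w)// mul1r.
Unshelve. all: by end_near. Qed.

Fact L0_mulDl : left_distributive L0_mul (@GRing.add L0).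
Proof.
move=> x y z; apply/L0_eqP; near=> w.
rewrite (near (L0_mulE (L0_add x y) z) w)// (near (L0_addE x y) w)//.
rewrite (near (L0_addE (L0_mul x z) (L0_mul y z)) w)//.
by rewrite (near (L0_mulE x z) w)// (near (L0_mulE y z) w)// mulrDl.
Unshelve. all: by end_near. Qed.

Fact L0_one_neq0 : L0_one != (0 : L0).
Proof.
apply/eqP => /L0_eqP h.
have : \forall w \near almost_everywhere P, False.
  apply: filterS3 h L0_zeroE L0_oneE => w hw zw ow.
  by move: (oner_neq0 R); rewrite -ow hw => /eqP; apply; exact: zw.
case=> A [mA A0 TA].
have : P [set: T] = 0%E.
  by rewrite (_ : setT = A) //; apply/seteqP; split => // w _; apply: TA.
by rewrite probability_setT => /eqP; rewrite onee_eq0.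
Qed.

HB.instance Definition _ := GRing.Zmodule_isComNzRing.Build L0
  L0_mulA L0_mulC L0_mul1r L0_mulDl L0_one_neq0.

Lemma L0_0E : {ae P, forall w, (0 : L0) w = 0}. Proof. exact: L0_zeroE. Qed.
Lemma L0_1E : {ae P, forall w, (1 : L0) w = 1}. Proof. exact: L0_oneE. Qed.
Lemma L0_DE (x y : L0) : {ae P, forall w, (x + y : L0) w = x w + y w}.
Proof. exact: L0_addE. Qed.
Lemma L0_NE (x : L0) : {ae P, forall w, (- x : L0) w = - x w}.
Proof. exact: L0_oppE. Qed.
Lemma L0_ME (x y : L0) : {ae P, forall w, (x * y : L0) w = x w * y w}.
Proof. exact: L0_mulE. Qed.

Definition L0_norm (x : L0) : L0 := \pi_L0 (pack_mfun (measurable_normr_mfun x)).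
(* the pointwise inverse, with 0^-1 = 0 *)
Definition L0_inv (x : L0) : L0 := \pi_L0 (pack_mfun (measurable_invr_mfun x)).
Definition L0_indic (A : set T) (mA : measurable A) : L0 := \pi_L0 (mindic R mA).

Lemma L0_normE (x : L0) : {ae P, forall w, L0_norm x w = `|x w|}.
Proof. exact: L0_piE. Qed.
Lemma L0_invE (x : L0) : {ae P, forall w, L0_inv x w = (x w)^-1}.
Proof. exact: L0_piE. Qed.
Lemma L0_indicE (A : set T) (mA : measurable A) :
  {ae P, forall w, L0_indic mA w = \1_A w}.
Proof. exact: L0_piE. Qed.

Definition L0pp : set L0 := [set x : L0 | {ae P, forall w, 0 < x w}].

Definition eL0_pinfty : eL0 := \pi_eL0 (cst +oo%E).
Definition eL0_of (x : L0) : eL0 := \pi_eL0 (pack_mfun (measurable_EFin_mfun x)).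

Lemma eL0_pinftyE : {ae P, forall w, eL0_pinfty w = +oo%E}.
Proof. exact: eL0_piE. Qed.
Lemma eL0_ofE (x : L0) : {ae P, forall w, eL0_of x w = (x w)%:E}.
Proof. exact: eL0_piE. Qed.

Definition eL0_zero : eL0 := \pi_eL0 (cst 0%E).
Definition eL0_add (x y : eL0) : eL0 := \pi_eL0 (pack_mfun (measurable_adde_mfun x y)).

Fact eL0_zeroE : {ae P, forall w, eL0_zero w = 0%E}. Proof. exact: eL0_piE. Qed.
Fact eL0_addE x y : {ae P, forall w, eL0_add x y w = (x w + y w)%E}.
Proof. exact: eL0_piE. Qed.

Fact eL0_addA : associative eL0_add.
Proof.
move=> x y z; apply/eL0_eqP; near=> w.
rewrite (near (eL0_addE x (eL0_add y z)) w)// (near (eL0_addE y z) w)//.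
by rewrite (near (eL0_addE (eL0_add x y) z) w)// (near (eL0_addE x y) w)// addeA.
Unshelve. all: by end_near. Qed.

Fact eL0_addC : commutative eL0_add.
Proof.
move=> x y; apply/eL0_eqP; near=> w.
by rewrite (near (eL0_addE x y) w)// (near (eL0_addE y x) w)// addeC.
Unshelve. all: by end_near. Qed.

Fact eL0_add0 : left_id eL0_zero eL0_add.
Proof.
move=> x; apply/eL0_eqP; near=> w.
by rewrite (near (eL0_addE _ x) w)// (near eL0_zeroE w)// add0e.
Unshelve. all: by end_near. Qed.

HB.instance Definition _ := GRing.isNmodule.Build eL0 eL0_addA eL0_addC eL0_add0.

Lemma eL0_0E : {ae P, forall w, (0 : eL0) w = 0%E}. Proof. exact: eL0_zeroE. Qed.
Lemma eL0_DE (x y : eL0) : {ae P, forall w, (x + y : eL0) w = (x w + y w)%E}.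
Proof. exact: eL0_addE. Qed.

(* [infimum] picks the greatest lower bound, which exists since the a.s. order *)
(* on [eL0] is a complete lattice; its default value is only used for the     *)
(* empty set, whose infimum is the top element.                               *)
Definition eL0_inf (H : set eL0) : eL0 := infimum eL0_pinfty H.

End L0.

Arguments L0pp {d T R} P.

Section countable_partition.
Context d (T : measurableType d).

Record cpartition := CPartition {
  cpart :> nat -> set T;
  cpart_measurable : forall n, measurable (cpart n);
  cpart_disjoint : trivIset [set: nat] cpart;
  cpart_cover : \bigcup_n cpart n = [set: T]
}.

Lemma cpart_index (A : cpartition) (w : T) : exists n, A n w.
Proof.
have : [set: T] w by [].
by rewrite -(cpart_cover A) => -[n _ Anw]; exists n.
Qed.

Lemma cpart_indic (R : realType) (A : cpartition) (m n : nat) (w : T) :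
  A m w -> \1_(A n) w = (m == n)%:R :> R.
Proof.
move=> Amw; rewrite indicE; case: eqVneq => [<-|mn]; first by rewrite mem_set.
rewrite memNset// => Anw; move/eqP : mn; apply.
by apply: (@cpart_disjoint A m n I I); exists w.
Qed.

End countable_partition.

Section glue.
Context d (T : measurableType d) (R : realType) (P : probability T R).
Variables (A : cpartition T) (u : nat -> eL0 P).
Local Open Scope ereal_scope.

Local Notation term n w := ((\1_(A n) w)%:E * u n w).

Lemma cpart_series_cvg m w : A m w ->
  (fun k => \sum_(0 <= n < k) term n w) @ \oo --> u m w.
Proof.
move=> Amw; apply: cvg_near_cst; near=> k.
have mk : (m < k)%N by near: k; exists m.+1.
rewrite (big_cat_nat (leq0n m) (ltnW mk))/= big_nat big1 ?add0e; last first.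
  by move=> n /andP[_ nm]; rewrite (cpart_indic _ n Amw) gtn_eqF ?mul0e.
rewrite big_ltn// (cpart_indic _ m Amw) eqxx mul1e big_nat big1 ?adde0//.
by move=> n /andP[mn _]; rewrite (cpart_indic _ n Amw) ltn_eqF ?mul0e.
Unshelve. all: by end_near. Qed.

Lemma cpart_seriesE m w : A m w -> \sum_(n <oo) term n w = u m w.
Proof. by move=> /cpart_series_cvg/(cvg_lim (@ereal_hausdorff R)). Qed.

Lemma measurable_cpart_series :
  measurable_fun [set: T] (fun w => \sum_(n <oo) (\1_(A n) w)%:E * u n w).
Proof.
apply: (emeasurable_fun_cvg (fun k w => \sum_(0 <= n < k) term n w)).
  move=> k; apply: emeasurable_sum => n; apply: emeasurable_funM => //.
  by apply/measurable_EFinP; apply: measurable_indic; exact: cpart_measurable.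
move=> w _; have [m Amw] := cpart_index A w.
by rewrite (cpart_seriesE Amw); exact: cpart_series_cvg.
Qed.

(* the class of \sum_n 1_(A n) * u n, with 0 * (+-oo) = 0 *)
Definition eL0_glue : eL0 P := \pi_(eL0 P) (pack_mfun measurable_cpart_series).

Lemma eL0_glueE : {ae P, forall w, forall m, A m w -> eL0_glue w = u m w}.
Proof.
have := eL0_piE P (pack_mfun measurable_cpart_series).
by apply: filterS => w -> m Amw; exact: cpart_seriesE.
Qed.

End glue.

Section RM_space.
Context d (T : measurableType d) (R : realType) (P : probability T R).

Record rmSpace := RMSpace {
  rm_sort :> Type;
  rm_dist : rm_sort -> rm_sort -> L0 P;
  rm_nonempty : inhabited rm_sort;
  rm_dist_ge0 : forall x y, 0 <= rm_dist x y;
  rm_dist_eq0 : forall x y, rm_dist x y = 0 <-> x = y;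
  rm_distC : forall x y, rm_dist x y = rm_dist y x;
  rm_dist_triangle :
    forall x y z, rm_dist x z <= rm_dist x y + rm_dist y z
}.

End RM_space.

Section RM_instances.
Context d (T : measurableType d) (R : realType) (P : probability T R).
Implicit Types x y z : L0 P.

Lemma L0_lerD x y x' y' : x <= x' -> y <= y' -> x + y <= x' + y'.
Proof.
move=> /L0_leP xx' /L0_leP yy'; apply/L0_leP.
near=> w; rewrite (near (L0_DE x y) w)// (near (L0_DE x' y') w)//.
by rewrite lerD// ?(near xx' w)// (near yy' w).
Unshelve. all: by end_near. Qed.

Definition L0_dist x y := L0_norm (x - y).

Fact L0_distE x y : {ae P, forall w, L0_dist x y w = `|x w - y w|}.
Proof.
near=> w; rewrite (near (L0_normE (x - y)) w)// (near (L0_DE x (- y)) w)//.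
by rewrite (near (L0_NE y) w).
Unshelve. all: by end_near. Qed.

Fact L0_dist_ge0 x y : 0 <= L0_dist x y.
Proof.
apply/L0_leP; near=> w.
by rewrite (near (L0_0E P) w)// (near (L0_distE x y) w).
Unshelve. all: by end_near. Qed.

Fact L0_dist_eq0 x y : L0_dist x y = 0 <-> x = y.
Proof.
rewrite !L0_eqP; split=> xy; near=> w.
  apply/eqP; rewrite -subr_eq0 -normr_eq0 -(near (L0_distE x y) w)//.
  by rewrite (near xy w)// (near (L0_0E P) w).
by rewrite (near (L0_distE x y) w)// (near xy w)// subrr normr0 (near (L0_0E P) w).
Unshelve. all: by end_near. Qed.

Fact L0_distC x y : L0_dist x y = L0_dist y x.
Proof.
apply/L0_eqP; near=> w.
by rewrite (near (L0_distE x y) w)// (near (L0_distE y x) w)// distrC.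
Unshelve. all: by end_near. Qed.

Fact L0_dist_triangle x y z : L0_dist x z <= L0_dist x y + L0_dist y z.
Proof.
apply/L0_leP; near=> w.
rewrite (near (L0_distE x z) w)// (near (L0_DE (L0_dist x y) (L0_dist y z)) w)//.
by rewrite (near (L0_distE x y) w)// (near (L0_distE y z) w)// ler_distD.
Unshelve. all: by end_near. Qed.

Definition L0_rmSpace : rmSpace P :=
  RMSpace (inhabits 0) L0_dist_ge0 L0_dist_eq0 L0_distC L0_dist_triangle.

Section product.
Variables E F : rmSpace P.

Definition prod_dist (p q : E * F) := rm_dist p.1 q.1 + rm_dist p.2 q.2.

Fact prod_rm_nonempty : inhabited (E * F).
Proof. by case: (rm_nonempty E) (rm_nonempty F) => x [y]; exists; exact: (x, y). Qed.

Fact prod_dist_ge0 p q : 0 <= prod_dist p q.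
Proof. by rewrite -(addr0 0) L0_lerD// rm_dist_ge0. Qed.

Fact prod_dist_eq0 p q : prod_dist p q = 0 <-> p = q.
Proof.
case: p q => [x y] [x' y']; rewrite /prod_dist/=; split=> [xy|[-> ->]]; last first.
  by rewrite !(proj2 (rm_dist_eq0 _ _))// addr0.
have le1 : rm_dist x x' <= 0.
  by rewrite -xy -[leLHS]addr0 L0_lerD// rm_dist_ge0.
have le2 : rm_dist y y' <= 0.
  by rewrite -xy -[leLHS]add0r L0_lerD// rm_dist_ge0.
congr pair; apply/rm_dist_eq0/eqP.
  by rewrite eq_le le1 rm_dist_ge0.
by rewrite eq_le le2 rm_dist_ge0.
Qed.

Fact prod_distC p q : prod_dist p q = prod_dist q p.
Proof. by congr (_ + _); exact: rm_distC. Qed.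

Fact prod_dist_triangle p q r : prod_dist p r <= prod_dist p q + prod_dist q r.
Proof. by rewrite /prod_dist addrACA L0_lerD// rm_dist_triangle. Qed.

Definition prod_rmSpace : rmSpace P :=
  RMSpace prod_rm_nonempty prod_dist_ge0 prod_dist_eq0 prod_distC prod_dist_triangle.

End product.

End RM_instances.

Section L0_uniformity.
Context d (T : measurableType d) (R : realType) (P : probability T R).
Variable E : rmSpace P.

HB.instance Definition _ := gen_eqMixin (rm_sort E).
HB.instance Definition _ := gen_choiceMixin (rm_sort E).

Definition rm_entourage : set_system (rm_sort E * rm_sort E) :=
  filter_from (L0pp P) (fun e => [set xy | rm_dist xy.1 xy.2 <= e]).

Fact rm_entourage_filter : Filter rm_entourage.
Proof.
apply: filter_from_filter.
  by exists 1; near=> w; rewrite (near (L0_1E P) w).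
move=> e1 e2 e10 e20.
exists (\pi_(L0 P) (min_mfun e1 e2)).
  near=> w; rewrite (near (L0_piE P (min_mfun e1 e2)) w)//=.
  by rewrite lt_min (near e10 w)// (near e20 w).
move=> xy /= /L0_leP xye; split; apply/L0_leP; near=> w.
  apply: (le_trans (near xye w _)) => //.
  by rewrite (near (L0_piE P (min_mfun e1 e2)) w)//= ge_min lexx.
apply: (le_trans (near xye w _)) => //.
by rewrite (near (L0_piE P (min_mfun e1 e2)) w)//= ge_min lexx orbT.
Unshelve. all: by end_near. Qed.

Fact rm_entourage_diag A : rm_entourage A -> diagonal `<=` A.
Proof.
move=> [e e0 eA] [x y] /diagonalP/= <-; apply: eA => /=.
rewrite (proj2 (rm_dist_eq0 _ _))//; apply/L0_leP; near=> w.
by rewrite (near (L0_0E P) w)// ltW// (near e0 w).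
Unshelve. all: by end_near. Qed.

Fact rm_entourage_inv A : rm_entourage A -> rm_entourage (A^-1)%relation.
Proof.
move=> [e e0 eA]; exists e => // -[x y]/= xye.
by apply: eA => /=; rewrite rm_distC.
Qed.

Fact rm_entourage_split A : rm_entourage A ->
  exists2 B, rm_entourage B & (B \; B)%relation `<=` A.
Proof.
move=> [e e0 eA].
have hE := L0_piE P ((e : {mfun T >-> R}) * cst 2^-1).
set h : L0 P := \pi_(L0 P) _ in hE.
exists [set xy | rm_dist xy.1 xy.2 <= h].
  exists h => //; near=> w; rewrite (near hE w)//=.
  by rewrite mulr_gt0 ?invr_gt0// (near e0 w).
move=> [x y] [z /= xz zy]; apply: eA => /=.
apply: (le_trans (rm_dist_triangle x z y)); apply: (le_trans (L0_lerD xz zy)).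
apply/L0_leP; near=> w; rewrite (near (L0_DE h h) w)// (near hE w)//=.
by rewrite -mulrDr -div1r -splitr mulr1.
Unshelve. all: by end_near. Qed.

HB.instance Definition _ := isUniform.Build (rm_sort E)
  rm_entourage_filter rm_entourage_diag rm_entourage_inv rm_entourage_split.

Definition rm_complete : Prop :=
  forall F : set_system E, ProperFilter F -> cauchy F -> exists x : E, F --> x.

(* x = \sum_n 1_(A n) * u n *)
Definition rm_glued (A : cpartition T) (u : nat -> E) (x : E) : Prop :=
  forall n, L0_indic P (cpart_measurable A n) * rm_dist x (u n) = 0.

Definition rm_sigma_stable : Prop :=
  forall (u : nat -> E) (A : cpartition T), exists x, rm_glued A u x.

Lemma rm_gluedP (A : cpartition T) (u : nat -> E) (x : E) :
  rm_glued A u x <->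
  forall n, {ae P, forall w, A n w -> rm_dist x (u n) w = 0}.
Proof.
have key n := L0_ME (L0_indic P (cpart_measurable A n)) (rm_dist x (u n)).
have iE n := L0_indicE P (cpart_measurable A n).
split=> xu n.
  have /L0_eqP xun := xu n.
  near=> w => Anw; have := near xun w; rewrite (near (key n) w)//.
  rewrite (near (iE n) w)// indicE mem_set// mul1r => ->//.
  by rewrite (near (L0_0E P) w).
apply/L0_eqP; near=> w.
rewrite (near (key n) w)// (near (iE n) w)// (near (L0_0E P) w)// indicE.
have [Anw|Anw] := boolP (w \in A n); last by rewrite mul0r.
by rewrite mul1r (near (xu n) w)//; exact: set_mem.
Unshelve. all: by end_near. Qed.

Lemma rm_glued_unique (A : cpartition T) (u : nat -> E) (x y : E) :
  rm_glued A u x -> rm_glued A u y -> x = y.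
Proof.
move=> /rm_gluedP/ae_foralln xu /rm_gluedP/ae_foralln yu.
apply/rm_dist_eq0/eqP; rewrite eq_le rm_dist_ge0 andbT; apply/L0_leP.
have /ae_foralln tri n := (L0_leP _ _).1 (rm_dist_triangle x (u n) y).
have /ae_foralln dE n := L0_DE (rm_dist x (u n)) (rm_dist (u n) y).
near=> w; have [n Anw] := cpart_index A w.
rewrite (near (L0_0E P) w)//.
have := near tri w _ n; rewrite (near dE w)// (near xu w)//.
by rewrite (rm_distC (u n)) (near yu w)// addr0; exact.
Unshelve. all: by end_near. Qed.

(* the element \sum_n 1_(A n) * u n of E *)
Definition rm_glue (hE : rm_sigma_stable) (A : cpartition T) (u : nat -> E) : E :=
  sval (cid (hE u A)).

Lemma rm_glueP (hE : rm_sigma_stable) (A : cpartition T) (u : nat -> E) :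
  rm_glued A u (rm_glue hE A u).
Proof. by rewrite /rm_glue; case: cid. Qed.

End L0_uniformity.

Section functions.
Context d (T : measurableType d) (R : realType) (P : probability T R).
Variables (E : rmSpace P) (f : E -> eL0 P).

Definition eL0_proper : Prop :=
  (forall x, {ae P, forall w, -oo < f x w}%E) /\
  exists x, {ae P, forall w, f x w < +oo}%E.

Definition eL0_epi : set (prod_rmSpace E (L0_rmSpace P)) :=
  [set p | f p.1 <= eL0_of p.2].

Definition eL0_lsc : Prop := closed eL0_epi.

Definition eL0_sigma_stable (hE : rm_sigma_stable E) : Prop :=
  forall (u : nat -> E) (A : cpartition T),
    f (rm_glue hE A u) = eL0_glue A (fun n => f (u n)).

Definition eL0_bounded_below : Prop :=
  exists eta : L0 P, forall x, eL0_of eta <= f x.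

End functions.

(* Main.v *)
Require Import Defs.
From mathcomp Require Import all_boot all_order all_algebra.
From mathcomp Require Import all_classical all_reals all_analysis.
From mathcomp Require Import measurable_realfun lra.

Import Order.TTheory GRing.Theory Num.Theory.

(** Ekeland's argument, with inequalities between random variables holding almost
surely.
Say that [x] descends to [y] when [f y + alpha * d(x, y) <= f x] almost surely.
This is a preorder; the point [z] sought is a descendant of [x0] whose only
descendant is itself ([exists_descends_minimal]). Conclusion (1) is then the
descent from [x0] to [z], and (2) compares it with [f x0 <= inf f + eps] and
[inf f <= f z]. For (3) let [x] be arbitrary and let [B] be the event where
[f x < f z - alpha * d(x, z)]. The point that equals [x] on [B] and [z]
elsewhere is a descendant of [z], hence is [z] itself, which forces
[f x = f z] on [B] and makes [B] negligible ([minimal_strict]).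

To build [z], choose greedily a sequence [u] of successive descendants of [x0].
Greed is measured by a real number: [eL0_mean g], the expectation of a bounded
strictly increasing transform of [g], is strictly monotone on classes of random
variables. Each [u (n + 1)] minimizes the mean of [f] among the descendants of
[u n] up to [1 / (n + 1)], so a common descendant of all the [u n] has minimal
mean among its own descendants and therefore admits no other one. The same
strict monotonicity shows that nonempty families in the extended lattice have
infima: a countable infimum of least possible mean is a lower bound.

There remains to find a common descendant. The values [f (u n)] decrease to
some [l], and the distances [d(u n, u m)], [m >= n], are bounded by
[r n = alpha^-1 * (f (u n) - l)], which tends to [0] almost surely. This is
weaker than being Cauchy in the uniformity at hand, whose entourages are indexed
by random radii without a uniform rate. The bridge is the countable
concatenation property: given a random radius [e], cut the sample space into
pieces on which some [r n] lies below [e], and glue the corresponding [u n]. The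
glued points approximate the limit to within [e] everywhere at once. They
generate a Cauchy filter, whence a limit [z] with [d(u n, z) <= r n]
([rm_complete_vanishing]); and they also approximate [(z, l)] from inside
the epigraph of [f], whence [f z <= l] by closedness ([eL0_lsc_le]). The two
bounds say exactly that every [u n] descends to [z]. *)

Set Implicit Arguments.
Unset Strict Implicit.
Unset Printing Implicit Defensive.

Local Open Scope classical_set_scope.
Local Open Scope quotient_scope.
Local Open Scope ring_scope.

(** * Means of bounded transforms and infima *)

Section scalarization.
Context d (T : measurableType d) (R : realType) (P : probability T R).
Implicit Types x y : eL0 P.

(** [contract] is an increasing bijection from the extended line onto [[-1, 1]],
so a half-line pulls back to everything, to nothing or to a half-line,
according to the position of its endpoint. *)
Lemma measurable_contract_mfun (g : {mfun T >-> \bar R}) :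
  measurable_fun [set: T] (fun w => contract (g w)).
Proof.
apply: (measurability _ (RGenOInfty.measurableE R)) => _ [_ [a ->] <-].
rewrite setTI.
have [a1|a1] := lerP `|a| 1; last first.
  have [a0|a0] := ltP 0 a.
    rewrite (_ : _ @^-1` _ = set0) //; apply/seteqP; split=> // w /=.
    rewrite in_itv/= andbT => aw; have := contract_le1 (g w).
    rewrite ler_norml => /andP[_ g1].
    by move: a1; rewrite gtr0_norm// ltNge (le_trans (ltW aw) g1).
  rewrite (_ : _ @^-1` _ = setT) //; apply/seteqP; split=> // w _ /=.
  rewrite in_itv/= andbT; have := contract_le1 (g w).
  rewrite ler_norml => /andP[g1 _]; apply: lt_le_trans g1.
  by move: a1; rewrite ler0_norm// ltrNr.
rewrite (_ : _ @^-1` _ = setT `&` [set w | (expand a < g w)%E]).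
  exact: emeasurable_fun_o_infty.
rewrite setTI; apply/seteqP; split=> w /=;
  by rewrite in_itv/= andbT lt_expandLR.
Qed.

(** The expectation of [x] itself need not exist; [contract] makes it finite and
keeps strict monotonicity. *)
Definition eL0_mean x : R := (\int[P]_w contract (x w))%R.

Lemma integrable_contract x :
  P.-integrable [set: T] (EFin \o (fun w => contract (x w))).
Proof.
apply: measurable_bounded_integrable => //.
- exact: fin_num_fun_lty.
- exact: measurable_contract_mfun.
- exists 1; split=> // M M1 w _; exact: (le_trans (contract_le1 _) (ltW M1)).
Qed.

(** When [x <= y] the gap between the means is an L1 distance: hence
monotonicity, and its strictness. *)
Lemma eL0_meanB x y : x <= y ->
  (\int[P]_w `| (contract (y w) - contract (x w))%:E |)%E
    = (eL0_mean y - eL0_mean x)%:E.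
Proof.
move=> /eL0_leP xy; rewrite -RintegralB//; do ?exact: integrable_contract.
have iB : P.-integrable [set: T]
    (fun w => (contract (y w) - contract (x w))%:E).
  rewrite (_ : (fun w => _) = (EFin \o (fun w => contract (y w))) \-
    (EFin \o (fun w => contract (x w))))%E.
    by apply: integrableB => //; exact: integrable_contract.
  by apply/funext => w /=; rewrite EFinB.
rewrite /Rintegral fineK; last exact: integrable_fin_num.
apply: ae_eq_integral => //.
- by apply: measurableT_comp => //; exact: measurable_int iB.
- exact: measurable_int iB.
- apply: filterS xy => w xyw _; rewrite gee0_abs// lee_fin subr_ge0.
  by rewrite le_contract.
Qed.

Lemma eL0_mean_le x y : x <= y -> eL0_mean x <= eL0_mean y.
Proof.
by move=> /eL0_meanB xy; rewrite -subr_ge0 -lee_fin -xy integral_ge0.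
Qed.

Lemma eL0_mean_inj_le x y : x <= y -> eL0_mean y <= eL0_mean x -> x = y.
Proof.
move=> xy yx; have := eL0_meanB xy.
have -> : eL0_mean y - eL0_mean x = 0.
  by apply/eqP; rewrite subr_eq0 eq_le yx eL0_mean_le.
move/ae_eq_integral_abs => -/(_ measurableT) h.
apply/eL0_eqP.
have /h : measurable_fun [set: T]
    (fun w => (contract (y w) - contract (x w))%:E).
  apply/measurable_EFinP/measurable_funB; exact: measurable_contract_mfun.
apply: filterS => w /(_ I) [] /eqP; rewrite subr_eq0 => /eqP /contract_inj.
by move->.
Qed.

Lemma measurable_einf (u : nat -> eL0 P) :
  measurable_fun [set: T] (fun w => einfs (u ^~ w) 0%N).
Proof. exact: measurable_fun_einfs. Qed.

Definition eL0_cinf (u : nat -> eL0 P) : eL0 P :=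
  \pi_(eL0 P) (pack_mfun (measurable_einf u)).

Lemma eL0_cinfE (u : nat -> eL0 P) :
  {ae P, forall w, eL0_cinf u w = ereal_inf (range (u ^~ w))}.
Proof.
have := eL0_piE P (pack_mfun (measurable_einf u)).
apply: filterS => w ->; rewrite /= /einfs; congr ereal_inf.
by apply/seteqP; split=> [_ [n _ <-]|_ [n _ <-]]; exists n.
Qed.

Lemma eL0_cinf_lb (u : nat -> eL0 P) n : eL0_cinf u <= u n.
Proof.
apply/eL0_leP; apply: filterS (eL0_cinfE u) => w ->.
by apply: ereal_inf_lbound; exists n.
Qed.

Lemma eL0_cinf_glb (u : nat -> eL0 P) x :
  (forall n, x <= u n) -> x <= eL0_cinf u.
Proof.
move=> xu; apply/eL0_leP.
have /ae_foralln xu' n := (eL0_leP x (u n)).1 (xu n).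
apply: filterS2 (eL0_cinfE u) xu' => w -> xuw.
by apply: le_ereal_inf_tmp => _ [n _ <-].
Qed.

(** Means are real numbers, bounded below by the mean of the class of [-oo]. *)
Lemma mean_almost_min (S : set (eL0 P)) (e : R) : S !=set0 -> 0 < e ->
  exists2 x, S x & forall y, S y -> eL0_mean x <= eL0_mean y + e.
Proof.
move=> S0 e0.
have hi : has_inf (eL0_mean @` S).
  split; first by case: S0 => x Sx; exists (eL0_mean x), x.
  exists (eL0_mean (\pi_(eL0 P) (cst -oo%E))) => _ [x _ <-]; apply: eL0_mean_le.
  apply/eL0_leP; apply: filterS (eL0_piE P (cst -oo%E)) => w ->.
  by rewrite leNye.
have [_ [x Sx <-] xe] := inf_adherent e0 hi.
exists x => // y Sy; apply: (le_trans (ltW xe)); rewrite lerD2r.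
by apply: ge_inf; [exact: hi.2 | exists y].
Qed.

(** Among countable infima of members of [H] there is one of least mean:
merge a minimizing sequence of countable families into a single family. Adding
any [h] of [H] to that family cannot lower the mean, hence by strict
monotonicity does not lower the infimum, so that the infimum lies below [h]. *)
Lemma eL0_infimums_nonempty (H : set (eL0 P)) : H !=set0 -> infimums H !=set0.
Proof.
move=> [h0 Hh0].
pose S := eL0_cinf @` [set u | forall k : nat, H (u k)].
have /choice[u uP] n : exists u : nat -> eL0 P, (forall k, H (u k)) /\
    forall y, S y -> eL0_mean (eL0_cinf u) <= eL0_mean y + n.+1%:R^-1.
  have [||_ [u Hu <-] umin] := @mean_almost_min S n.+1%:R^-1.
  - by exists (eL0_cinf (fun=> h0)), (fun=> h0).
  - by rewrite invr_gt0.
  - by exists u.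
pose v m :=
  let p := odflt (0, 0)%N (unpickle m : option (nat * nat)) in u p.1 p.2.
have Hv m : H (v m) by apply: (uP _).1.
have vu n : eL0_cinf v <= eL0_cinf (u n).
  apply: eL0_cinf_glb => k.
  by have := eL0_cinf_lb v (pickle (n, k)); rewrite /v pickleK.
have vmin y : S y -> eL0_mean (eL0_cinf v) <= eL0_mean y.
  move=> Sy; apply/ler_addgt0Pr => e e0.
  have [n ne] := ltr_add_invr e0.
  rewrite add0r in ne.
  apply: (le_trans (eL0_mean_le (vu n))); apply: (le_trans ((uP n).2 y Sy)).
  by rewrite lerD2l ltW.
exists (eL0_cinf v); split=> [h Hh|x xH]; last first.
  by apply: eL0_cinf_glb => n; apply: xH.
pose w m := if m is m'.+1 then v m' else h.
have wv : eL0_cinf w <= eL0_cinf v.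
  by apply: eL0_cinf_glb => n; exact: (eL0_cinf_lb w n.+1).
have <- : eL0_cinf w = eL0_cinf v; last exact: (eL0_cinf_lb w 0%N).
apply: eL0_mean_inj_le => //; apply: vmin; exists w => // -[|k] //=.
Qed.

(** The existence of infima matters: failing that, [eL0_inf] is a default value. *)
Lemma eL0_inf_le (H : set (eL0 P)) (h : eL0 P) : H h -> eL0_inf H <= h.
Proof.
move=> Hh; have H0 : H !=set0 by exists h.
rewrite /eL0_inf /infimum ifF; last exact/negbTE/set0P.
by have [+ _] := xgetPex (eL0_pinfty P) (eL0_infimums_nonempty H0); exact.
Qed.

End scalarization.

(** * Random radii and countable partitions *)

Section L0_order.
Context d (T : measurableType d) (R : realType) (P : probability T R).
Implicit Types x y e : L0 P.

Lemma L0pp_min e1 e2 : L0pp P e1 -> L0pp P e2 ->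
  exists2 e, L0pp P e & e <= e1 /\ e <= e2.
Proof.
move=> e10 e20; have mE := L0_piE P (min_mfun e1 e2).
exists (\pi_(L0 P) (min_mfun e1 e2)).
  by near=> w; rewrite (near mE w)//= lt_min (near e10 w)// (near e20 w).
by split; apply/L0_leP; near=> w; rewrite (near mE w)//= ge_min lexx ?orbT.
Unshelve. all: by end_near. Qed.

Lemma L0pp_half e : L0pp P e -> exists2 h, L0pp P h & h + h = e.
Proof.
move=> e0; have hE := L0_piE P ((e : {mfun T >-> R}) * cst 2^-1).
set h : L0 P := \pi_(L0 P) _ in hE.
exists h.
  by near=> w; rewrite (near hE w)//= mulr_gt0 ?invr_gt0 ?(near e0 w).
apply/L0_eqP; near=> w; rewrite (near (L0_DE h h) w)// (near hE w)//=.
by rewrite -mulrDr -div1r -splitr mulr1.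
Unshelve. all: by end_near. Qed.

(** The constant radii [1 / (n + 1)] already suffice, which keeps the
exceptional sets countable in number. *)
Lemma L0_le_addpp x y : (forall e, L0pp P e -> x <= y + e) -> x <= y.
Proof.
move=> xy; apply/L0_leP.
pose c n : L0 P := \pi_(L0 P) (cst n.+1%:R^-1).
have cE n : {ae P, forall w, c n w = n.+1%:R^-1} by exact: L0_piE.
have c0 n : L0pp P (c n) by near=> w; rewrite (near (cE n) w)// invr_gt0.
have /ae_foralln cE' := cE.
have /ae_foralln xyc n := (L0_leP _ _).1 (xy _ (c0 n)).
have /ae_foralln DE n := L0_DE y (c n).
near=> w; apply/ler_addgt0Pr => e e_gt0.
have [n ne] := ltr_add_invr e_gt0; rewrite add0r in ne.
have := near xyc w _ n; rewrite (near DE w)// (near cE' w)// => h.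
by apply: (le_trans (h _)) => //; rewrite lerD2l ltW.
Unshelve. all: by end_near. Qed.

(** For nonnegative nonincreasing sequences this is almost sure convergence to
[0]; only the existence of small terms matters for gluing. *)
Definition L0_vanishing (s : nat -> L0 P) : Prop :=
  {ae P, forall w, forall e : R, 0 < e -> exists n, s n w <= e}.

(** Keep of each [B n] what the previous ones have not covered. A partition has
to exhaust the whole space, so the negligible rest is put in the first piece. *)
Lemma cpartition_within (B : nat -> set T) :
  (forall n, measurable (B n)) -> {ae P, forall w, exists n, B n w} ->
  exists A : cpartition T, {ae P, forall w, forall n, A n w -> B n w}.
Proof.
move=> mB covB; pose B' := fun n => B n `|` ~` \bigcup_k B k.
have mB' n : measurable (B' n).
  by apply: measurableU => //; apply/measurableC/bigcup_measurable.
have covB' : \bigcup_n seqDU B' n = [set: T].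
  rewrite -seqDU_bigcup_eq; apply/seteqP; split=> // w _.
  have [[n _ Bnw]|nB] := pselect ((\bigcup_k B k) w).
    by exists n => //; left.
  by exists 0%N => //; right.
exists (CPartition (seqDU_measurable mB') (trivIset_seqDU B') covB').
apply: filterS covB => w [k Bkw] n /(@subset_seqDU _ B') -[//|].
by move=> nB; case: nB; exists k.
Qed.

Lemma cpartition_small (s : nat -> L0 P) e : L0_vanishing s -> L0pp P e ->
  exists A : cpartition T, {ae P, forall w, forall n, A n w -> s n w <= e w}.
Proof.
move=> s0 e0; apply: (cpartition_within (B := fun n => [set w | s n w <= e w])).
  by move=> n; rewrite -[X in measurable X]setTI; exact: measurable_fun_le.
by apply: filterS2 s0 e0 => w; exact.
Qed.

End L0_order.

(** * Completeness and lower semicontinuity along sequences *)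

Section rm_space.
Context d (T : measurableType d) (R : realType) (P : probability T R).
Variable E : rmSpace P.

(** The entourages [d <= e], for random radii [e], form a base. *)
Lemma rm_dist_small_closed (D : set E) (p : E) : closed D ->
  (forall e, L0pp P e -> exists2 q, D q & rm_dist p q <= e) -> D p.
Proof.
move=> cD Dp; apply: cD => B /nbhsP[A [e e0 eA] AB].
have [q Dq pq] := Dp e e0; exists q; split=> //.
by apply: AB; apply/xsectionP; exact: eA.
Qed.

(** Stability only gives [d(x, u n) = 0] on [A n]; the triangle inequality
transfers this to the distances to a third point. *)
Lemma rm_dist_glued (A : cpartition T) (u : nat -> E) (x y : E) :
  rm_glued A u x ->
  {ae P, forall w, forall n, A n w -> rm_dist x y w = rm_dist (u n) y w}.
Proof.
move=> /rm_gluedP/ae_foralln xu.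
have /ae_foralln t1 n := (L0_leP _ _).1 (rm_dist_triangle x (u n) y).
have /ae_foralln t2 n := (L0_leP _ _).1 (rm_dist_triangle (u n) x y).
have /ae_foralln d1 n := L0_DE (rm_dist x (u n)) (rm_dist (u n) y).
have /ae_foralln d2 n := L0_DE (rm_dist (u n) x) (rm_dist x y).
near=> w => n Anw; apply/eqP; rewrite eq_le.
have xun := near xu w _ n Anw.
have := near t1 w _ n; have := near t2 w _ n.
rewrite (near d1 w)// (near d2 w)// (rm_distC (u n) x) xun// !add0r.
by move=> -> // ->.
Unshelve. all: by end_near. Qed.

(** Let [D e] be the set of [y] with [d(y, u n) <= r n + e] for all [n], that
is, the approximate limits of [u] to within the random radius [e]. Gluing the
[u n] along a partition on which [r n <= e] yields a point of [D e], and since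
[r] gets arbitrarily small any two points of [D e] are at distance at most
[2 e]. So the [D e] form a Cauchy filter base, and its limit satisfies the
bounds with [e] removed. *)
Lemma rm_complete_vanishing (hE : rm_sigma_stable E) (hEc : rm_complete E)
    (u : nat -> E) (r : nat -> L0 P) :
  (forall n m, (n <= m)%N -> rm_dist (u n) (u m) <= r n) -> L0_vanishing r ->
  exists z, forall n, rm_dist (u n) z <= r n.
Proof.
move=> ur r0.
have r_ge0 n : 0 <= r n.
  by apply: le_trans (ur n n (leqnn n)); exact: rm_dist_ge0.
pose D e := [set y | forall n, rm_dist y (u n) <= r n + e].
have D0 e : L0pp P e -> D e !=set0.
  move=> e0; have [A Ar] := cpartition_small r0 e0.
  have [y yA] := hE u A; exists y => n; apply/L0_leP.
  have yE := rm_dist_glued (u n) yA.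
  have /ae_foralln r_ge0' k := (L0_leP 0 (r k)).1 (r_ge0 k).
  have z0 := L0_0E P.
  have DE := L0_DE (r n) e.
  have /ae_foralln d1 m :
      {ae P, forall w, (n <= m)%N -> rm_dist (u n) (u m) w <= r n w}.
    case: (leqP n m) => nm; last by near=> w.
    by have /L0_leP := ur n m nm; apply: filterS.
  have /ae_foralln d2 m :
      {ae P, forall w, (m <= n)%N -> rm_dist (u m) (u n) w <= r m w}.
    case: (leqP m n) => nm; last by near=> w.
    by have /L0_leP := ur m n nm; apply: filterS.
  near=> w; have [N ANw] := cpart_index A w.
  rewrite (near yE w _ N)// (near DE w)//.
  have e0w : 0 < e w by near: w.
  have rn : 0 <= r n w by rewrite -(near z0 w)// (near r_ge0' w).
  (* If the piece containing [w] carries an index [N >= n], then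
     [d(u N, u n)] is at most [r n]; otherwise it is at most [r N <= e]. *)
  case: (leqP n N) => nN.
    rewrite rm_distC (le_trans (near d1 w _ N nN))// lerDl ltW//.
  rewrite (le_trans (near d2 w _ N (ltnW nN)))//.
  by rewrite (le_trans (near Ar w _ N ANw))// lerDr.
have FD : ProperFilter (filter_from (L0pp P) D).
  apply: filter_from_proper => //; apply: filter_from_filter.
    by exists 1; near=> w; rewrite (near (L0_1E P) w).
  move=> e1 e2 e10 e20; have [e e0 [ee1 ee2]] := L0pp_min e10 e20.
  exists e => // y Dy; split=> n; apply: (le_trans (Dy n)); exact: L0_lerD.
have [z Dz] : exists z : E, filter_from (L0pp P) D --> z.
  apply: hEc => A [e e0 eA]; have [h h0 he] := L0pp_half e0.
  exists (D h, D h); first by split; exists h.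
  move=> [y y'] /= [Dy Dy']; apply: eA => /=; apply/L0_leP.
  have /ae_foralln t n := (L0_leP _ _).1 (rm_dist_triangle y (u n) y').
  have /ae_foralln tE n := L0_DE (rm_dist y (u n)) (rm_dist (u n) y').
  have /ae_foralln b1 n := (L0_leP _ _).1 (Dy n).
  have /ae_foralln b2 n := (L0_leP _ _).1 (Dy' n).
  have /ae_foralln bE n := L0_DE (r n) h.
  have hE' := L0_DE h h.
  rewrite -he; near=> w; rewrite (near hE' w)//; apply/ler_addgt0Pr => g g0.
  (* At the sample point [w], choose [n] with [r n <= g / 2] in
     [d(y, y') <= 2 (r n + h)]. *)
  have g2 : 0 < g / 2 by rewrite divr_gt0.
  have [//|n rn] := near r0 w _ _ g2.
  have tn : rm_dist y y' w <= (rm_dist y (u n) + rm_dist (u n) y' : L0 P) w.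
    exact: (near t w).
  have b1n : rm_dist y (u n) w <= (r n + h : L0 P) w by exact: (near b1 w).
  have b2n : rm_dist y' (u n) w <= (r n + h : L0 P) w by exact: (near b2 w).
  move: tn b1n b2n.
  rewrite (near tE w)// (rm_distC (u n)) (near bE w)// => tn b1n b2n.
  lra.
exists z => n; apply: L0_le_addpp => e e0; have [h h0 <-] := L0pp_half e0.
have zh : nbhs z [set y | rm_dist z y <= h].
  apply/nbhsP; exists [set xy | rm_dist xy.1 xy.2 <= h]; first by exists h.
  by move=> y /xsectionP.
have [y [zy Dy]] : [set y | rm_dist z y <= h] `&` D h !=set0.
  apply: (@filter_ex _ (filter_from (L0pp P) D)).
  by apply: filterI; [exact: Dz | exists h].
rewrite addrA; apply: (le_trans (rm_dist_triangle _ y _)); apply: L0_lerD.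
  by rewrite rm_distC.
by rewrite rm_distC.
Unshelve. all: by end_near. Qed.

End rm_space.

Section lsc.
Context d (T : measurableType d) (R : realType) (P : probability T R).
Variable E : rmSpace P.

(** Glue the [u n] along a partition on which [r n + t n] is below a given
random radius [h]. By stability of [f] the glued point [y] satisfies
[f y <= l + h], and it is within [h] of [z]: thus [(z, l)] is adherent to the epigraph. *)
Lemma eL0_lsc_le (hE : rm_sigma_stable E) (f : E -> eL0 P)
    (hfs : eL0_sigma_stable f hE) (hfl : eL0_lsc f)
    (u : nat -> E) (t r : nat -> L0 P) (z : E) (l : L0 P) :
  (forall n, f (u n) <= eL0_of (l + t n)) ->
  (forall n, rm_dist (u n) z <= r n) ->
  L0_vanishing (fun n => r n + t n) ->
  (forall n, 0 <= t n) ->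
  f z <= eL0_of l.
Proof.
move=> ft ur rt0 t_ge0.
have r_ge0 n : 0 <= r n by apply: le_trans (ur n); exact: rm_dist_ge0.
have zl : eL0_epi f (z, l); last exact: zl.
apply: (@rm_dist_small_closed _ _ _ _
  (prod_rmSpace E (L0_rmSpace P)) _ (z, l) hfl).
move=> e e0.
have [h h0 he] := L0pp_half e0.
have [A As] := cpartition_small rt0 h0.
have yA := rm_glueP hE A u.
have fy := eL0_glueE A (fun n => f (u n)); rewrite -(hfs u A) in fy.
set y := rm_glue hE A u in yA fy.
have rtE : {ae P, forall w n, (r n + t n : L0 P) w = r n w + t n w}.
  by apply: ae_foralln => n; exact: L0_DE.
have r_ge0' : {ae P, forall w n, (0 : L0 P) w <= r n w}.
  by apply: ae_foralln => n; exact/L0_leP.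
have t_ge0' : {ae P, forall w n, (0 : L0 P) w <= t n w}.
  by apply: ae_foralln => n; exact/L0_leP.
have z0 := L0_0E P.
exists (y, l + h) => /=.
  rewrite /eL0_epi/=; apply/eL0_leP.
  have /ae_foralln ft' n := (eL0_leP _ _).1 (ft n).
  have /ae_foralln ltE n := L0_DE l (t n).
  have /ae_foralln oE n := eL0_ofE (l + t n).
  have lhE := L0_DE l h; have ohE := eL0_ofE (l + h).
  near=> w; have [n Anw] := cpart_index A w.
  rewrite (near fy w _ n)//.
  have ft'n : (f (u n) w <= eL0_of (l + t n)%R w)%E by exact: (near ft' w).
  apply: (le_trans ft'n); rewrite (near oE w)// (near ohE w)// lee_fin.
  rewrite (near ltE w)// (near lhE w)// lerD2l.
  apply: le_trans (near As w _ n Anw) => //; rewrite (near rtE w)//.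
  by rewrite lerDr -(near z0 w)// (near r_ge0' w).
rewrite /prod_dist/= -he; apply: L0_lerD; apply/L0_leP.
  have yE := rm_dist_glued z yA.
  have /ae_foralln ur' n := (L0_leP _ _).1 (ur n).
  near=> w; have [n Anw] := cpart_index A w.
  rewrite rm_distC (near yE w _ n)//; apply: (le_trans (near ur' w _ n)) => //.
  apply: le_trans (near As w _ n Anw) => //; rewrite (near rtE w)//.
  by rewrite lerDl -(near z0 w)// (near t_ge0' w).
have dE := L0_distE l (l + h); have lhE := L0_DE l h.
near=> w; rewrite (near dE w)// (near lhE w)// opprD addNKr normrN.
by rewrite gtr0_norm// (near h0 w).
Unshelve. all: by end_near. Qed.

End lsc.

(** * Arithmetic of random variables *)

Section eL0_arith.
Context d (T : measurableType d) (R : realType) (P : probability T R).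
Implicit Types (x y : eL0 P) (a b c : L0 P).

Lemma eL0_leD x x' y y' : x <= x' -> y <= y' -> x + y <= x' + y'.
Proof.
move=> /eL0_leP xx' /eL0_leP yy'; apply/eL0_leP; near=> w.
rewrite (near (eL0_DE x y) w)// (near (eL0_DE x' y') w)//.
by apply: leeD; [exact: (near xx' w)|exact: (near yy' w)].
Unshelve. all: by end_near. Qed.

Lemma eL0_of_le a b : (eL0_of a <= eL0_of b) = (a <= b).
Proof.
by apply/idP/idP=> [/eL0_leP|/L0_leP] ab;
  [apply/L0_leP|apply/eL0_leP]; near=> w; move: (near ab w);
  rewrite (near (eL0_ofE a) w)// (near (eL0_ofE b) w)// lee_fin; exact.
Unshelve. all: by end_near. Qed.

Lemma eL0_of0 : eL0_of (0 : L0 P) = 0.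
Proof.
apply/eL0_eqP; near=> w.
by rewrite (near (eL0_ofE _) w)// (near (L0_0E P) w)// (near (eL0_0E P) w).
Unshelve. all: by end_near. Qed.

Lemma eL0_ofD a b : eL0_of (a + b) = eL0_of a + eL0_of b.
Proof.
apply/eL0_eqP; near=> w.
rewrite (near (eL0_ofE (a + b)) w)// (near (L0_DE a b) w)//.
rewrite (near (eL0_DE (eL0_of a) (eL0_of b)) w)//.
by rewrite (near (eL0_ofE a) w)// (near (eL0_ofE b) w)// EFinD.
Unshelve. all: by end_near. Qed.

Lemma eL0_addrK x a : x + eL0_of a + eL0_of (- a) = x.
Proof. by rewrite -addrA -eL0_ofD subrr eL0_of0 addr0. Qed.

Lemma eL0_leBrDr x y a : (x + eL0_of a <= y) = (x <= y + eL0_of (- a)).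
Proof.
apply/idP/idP => h.
  by rewrite -(eL0_addrK x a) eL0_leD.
by rewrite -(eL0_addrK y (- a)) opprK eL0_leD.
Qed.

Lemma eL0_of_finite x : {ae P, forall w, x w \is a fin_num} ->
  exists a, x = eL0_of a.
Proof.
move=> xfin; have mf : measurable_fun [set: T] (fun w => fine (x w)).
  exact: measurableT_comp (fine_measurable measurableT) _.
exists (\pi_(L0 P) (pack_mfun mf)); apply/eL0_eqP.
have pE := L0_piE P (pack_mfun mf).
near=> w; rewrite (near (eL0_ofE _) w)// (near pE w)//= fineK//.
exact: (near xfin w).
Unshelve. all: by end_near. Qed.

Lemma eL0_of_sandwich x y a : eL0_of a <= x -> x <= y ->
  {ae P, forall w, y w < +oo}%E -> exists b, x = eL0_of b.
Proof.
move=> /eL0_leP ax /eL0_leP xy yfin; apply: eL0_of_finite.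
near=> w; rewrite fin_real//; apply/andP; split.
  apply: lt_le_trans (near ax w _) => //.
  by rewrite (near (eL0_ofE a) w)// ltNyr.
by apply: (le_lt_trans (near xy w _)) => //; near: w.
Unshelve. all: by end_near. Qed.

Lemma L0_mul_ge0 a b : 0 <= a -> 0 <= b -> 0 <= a * b.
Proof.
move=> /L0_leP a0 /L0_leP b0; apply/L0_leP; have z := L0_0E P.
near=> w; rewrite (near (L0_ME a b) w)// (near z w)// mulr_ge0//.
  by rewrite -(near z w)// (near a0 w).
by rewrite -(near z w)// (near b0 w).
Unshelve. all: by end_near. Qed.

Lemma L0_ler_pM2l e a b : L0pp P e -> (e * a <= e * b) = (a <= b).
Proof.
move=> e0.
by apply/idP/idP=> /L0_leP ab; apply/L0_leP; near=> w; move: (near ab w);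
  rewrite (near (L0_ME e a) w)// (near (L0_ME e b) w)// ler_pM2l;
  [exact | exact: (near e0 w) | exact | exact: (near e0 w)].
Unshelve. all: by end_near. Qed.

Lemma L0_mulKl e a : L0pp P e -> e * (L0_inv e * a) = a.
Proof.
move=> e0; apply/L0_eqP; near=> w.
rewrite (near (L0_ME e (L0_inv e * a)) w)// (near (L0_ME (L0_inv e) a) w)//.
by rewrite (near (L0_invE e) w)// mulVKf// gt_eqF// (near e0 w).
Unshelve. all: by end_near. Qed.

Lemma L0_leBrDr a b c : (a <= b - c) = (a + c <= b).
Proof.
apply/idP/idP => h.
  by rewrite -(subrK c b) L0_lerD.
by rewrite -(addrK c a) L0_lerD.
Qed.

End eL0_arith.

(** * Descent *)

Section ekeland.
Context d (T : measurableType d) (R : realType) (P : probability T R).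
Variables (E : rmSpace P) (f : E -> eL0 P) (alpha : L0 P).
Hypothesis alpha_gt0 : L0pp P alpha.
Implicit Types x y z : E.

Definition descends (x y : E) : Prop :=
  f y + eL0_of (alpha * rm_dist x y) <= f x.

Lemma descends_refl x : descends x x.
Proof.
by rewrite /descends (proj2 (rm_dist_eq0 x x))// mulr0 eL0_of0 addr0.
Qed.

Lemma alpha_dist_ge0 x y : 0 <= alpha * rm_dist x y.
Proof.
apply: L0_mul_ge0; last exact: rm_dist_ge0.
have z := L0_0E P; apply/L0_leP; near=> w.
by rewrite (near z w)// ltW// (near alpha_gt0 w).
Unshelve. all: by end_near. Qed.

Lemma descends_trans x y z : descends x y -> descends y z -> descends x z.
Proof.
move=> xy yz; apply: le_trans xy; apply: le_trans (eL0_leD yz (lexx _)).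
rewrite -addrA -eL0_ofD eL0_leD// eL0_of_le -mulrDr L0_ler_pM2l// addrC.
exact: rm_dist_triangle.
Qed.

Lemma descends_le x y : descends x y -> f y <= f x.
Proof.
apply: le_trans; rewrite -[leLHS]addr0 eL0_leD// -eL0_of0 eL0_of_le.
exact: alpha_dist_ge0.
Qed.

(** The tolerance [1 / (n + 1)] tends to [0], so no common descendant of the
[u n] can have a mean below the limit of the means along [u]. *)
Lemma greedy_descent (x0 : E) : exists u : nat -> E,
  [/\ u 0%N = x0, forall n m, (n <= m)%N -> descends (u n) (u m) &
      forall n y, descends (u n) y ->
        eL0_mean (f (u n.+1)) <= eL0_mean (f y) + n.+1%:R^-1].
Proof.
have /choice[g gP] (p : nat * E) : exists y, descends p.2 y /\
    forall y', descends p.2 y' ->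
      eL0_mean (f y) <= eL0_mean (f y') + p.1.+1%:R^-1.
  have [||_ [y py <-] ymin] :=
      @mean_almost_min _ _ _ P (f @` [set y | descends p.2 y]) p.1.+1%:R^-1.
  - by exists (f p.2), p.2 => //; exact: descends_refl.
  - by rewrite invr_gt0.
  - by exists y; split=> // y' py'; apply: ymin; exists y'.
pose u := fix u n := if n is m.+1 then g (m, u m) else x0.
exists u; split=> // [n m|n y uy]; last exact: (gP (n, u n)).2.
elim: m => [|m IH].
  by rewrite leqn0 => /eqP ->; exact: descends_refl.
rewrite leq_eqVlt ltnS => /orP[/eqP->|/IH nm]; first exact: descends_refl.
by apply: descends_trans nm _; exact: (gP (m, u m)).1.
Qed.

Hypotheses (hE : rm_sigma_stable E) (hEc : rm_complete E).
Hypotheses (hfs : eL0_sigma_stable f hE) (hfl : eL0_lsc f).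
Hypothesis (hfb : eL0_bounded_below f).

(** With [l] the infimum of the values and [t n = f (u n) - l], descent from
[u n] to [u m] gives [alpha * d(u n, u m) <= f (u n) - f (u m) <= t n]; so
[u] converges to some [z] at rate [alpha^-1 * t n], and [f z <= l]. Adding up,
[f z + alpha * d(u n, z) <= l + t n = f (u n)]. *)
Lemma descends_chain_limit (u : nat -> E) :
  {ae P, forall w, f (u 0%N) w < +oo}%E ->
  (forall n m, (n <= m)%N -> descends (u n) (u m)) ->
  exists z, forall n, descends (u n) z.
Proof.
move=> u0 uS; have [eta etaf] := hfb.
have /choice[F FE] n : exists a, f (u n) = eL0_of a.
  by apply: eL0_of_sandwich (etaf _) _ u0; apply: descends_le; exact: uS.
have [l lE] : exists l, eL0_cinf (f \o u) = eL0_of l.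
  apply: eL0_of_sandwich (eL0_cinf_lb (f \o u) 0%N) u0.
  by apply: eL0_cinf_glb => n; exact: etaf.
have lF n : l <= F n by rewrite -eL0_of_le -lE -FE; exact: eL0_cinf_lb.
pose t n := F n - l; pose r n := L0_inv alpha * t n.
have t_ge0 n : 0 <= t n.
  by rewrite -(subrr l) L0_lerD.
have ur n m : (n <= m)%N -> rm_dist (u n) (u m) <= r n.
  move=> nm; rewrite -(@L0_ler_pM2l _ _ _ P alpha)// L0_mulKl//.
  have := uS _ _ nm; rewrite /descends !FE -eL0_ofD eL0_of_le => h.
  rewrite /t L0_leBrDr; apply: le_trans h; rewrite addrC.
  by rewrite L0_lerD.
have rt0 : L0_vanishing (fun n => r n + t n).
  have /ae_foralln FE' n := (eL0_eqP _ _).1 (FE n).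
  have /ae_foralln oE n := eL0_ofE (F n).
  have /ae_foralln r1 n := L0_ME (L0_inv alpha) (t n).
  have /ae_foralln t1 n := L0_DE (F n) (- l).
  have /ae_foralln rt n := L0_DE (r n) (t n).
  have lN := L0_NE l; have iE := L0_invE alpha.
  have lE' := (eL0_eqP _ _).1 lE; have lo := eL0_ofE l.
  have cE := eL0_cinfE (f \o u).
  near=> w => e e0.
  have a0 : 0 < alpha w by near: w.
  (* [r n + t n = c * t n], so it suffices to find [t n] below [e / c]. *)
  pose c := (alpha w)^-1 + 1.
  have c0 : 0 < c by rewrite addr_gt0// invr_gt0.
  have : (ereal_inf (range ((f \o u) ^~ w)) < (l w + e / c)%:E)%E.
    rewrite -(near cE w)// (near lE' w)// (near lo w)// lte_fin ltrDl.
    by rewrite divr_gt0.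
  move=> /ereal_inf_lt[_ [n _ <-]] /=.
  rewrite (near FE' w)// (near oE w)// lte_fin => Fn; exists n.
  rewrite (near rt w)// (near r1 w)// (near t1 w)// (near lN w)// (near iE w)//.
  rewrite -[X in _ + X]mul1r -mulrDl -/c mulrC -ler_pdivlMr//.
  by rewrite lerBlDl ltW.
have r0 : L0_vanishing r.
  have /ae_foralln t_ge0' n := (L0_leP _ _).1 (t_ge0 n).
  have /ae_foralln rt n := L0_DE (r n) (t n).
  have z0 := L0_0E P.
  near=> w => e e0; have [//|n ne] := near rt0 w _ _ e0; exists n.
  apply: le_trans ne; rewrite (near rt w)// lerDl -(near z0 w)//.
  by rewrite (near t_ge0' w).
have [z uz] := rm_complete_vanishing hE hEc ur r0.
have fz : f z <= eL0_of l.
  apply: (eL0_lsc_le hfs hfl _ uz rt0 t_ge0) => n.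
  by rewrite FE /t addrC subrK.
exists z => n; rewrite /descends FE -(subrK l (F n)) addrC eL0_ofD eL0_leD//.
by rewrite eL0_of_le -[leRHS](@L0_mulKl _ _ _ P alpha)// L0_ler_pM2l.
Unshelve. all: by end_near. Qed.

(** A descendant [y] of the limit [z] descends from every [u n], so its mean is
at least that of [z] up to [1 / (n + 1)]; strict monotonicity gives [f y = f z].
As this value is finite, the descent from [z] to [y] leaves no room for a
positive distance. *)
Lemma exists_descends_minimal (x0 : E) : {ae P, forall w, f x0 w < +oo}%E ->
  exists2 z, descends x0 z & forall y, descends z y -> y = z.
Proof.
move=> x0fin; have [u [u0 uS umin]] := greedy_descent x0.
have [|z uz] := descends_chain_limit _ uS; first by rewrite u0.
exists z; first by rewrite -u0.
move=> y zy; have [eta etaf] := hfb.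
have fyz : f y = f z.
  apply: eL0_mean_inj_le; first exact: descends_le.
  apply/ler_addgt0Pr => e e0; have [n] := ltr_add_invr e0.
  rewrite add0r => /ltW ne.
  apply: le_trans (eL0_mean_le (descends_le (uz n.+1))) _.
  apply: le_trans (umin n y (descends_trans (uz n) zy)) _.
  by rewrite lerD2l.
have [a fza] : exists a, f z = eL0_of a.
  by apply: eL0_of_sandwich (etaf z) _ x0fin; apply: descends_le; rewrite -u0.
move: zy; rewrite /descends fyz fza -eL0_ofD eL0_of_le => h.
apply/esym/rm_dist_eq0/eqP; rewrite eq_le rm_dist_ge0 andbT.
rewrite -(@L0_ler_pM2l _ _ _ P alpha)// mulr0 -(addKr a (_ * _)) -(addNr a).
by rewrite L0_lerD.
Qed.

(** Equality of [f x] with [f z - alpha * d(x, z)] would make [x] a descendant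
of [z]. For the inequality, glue [x] on the event where it fails with [z] on its
complement. *)
Lemma minimal_strict (z x : E) : (forall y, descends z y -> y = z) -> x <> z ->
  f z + eL0_of (- (alpha * rm_dist x z)) <= f x /\
  f x <> f z + eL0_of (- (alpha * rm_dist x z)).
Proof.
move=> zmin xz; set b : L0 P := alpha * rm_dist x z.
split=> [|fx]; last first.
  by apply/xz/zmin; rewrite /descends rm_distC eL0_leBrDr fx.
pose g : eL0 P := f z + eL0_of (- b).
pose B n := if n is 0 then [set w | (f x w < g w)%E]
            else ~` [set w | (f x w < g w)%E].
have mB n : measurable (B n).
  have m0 : measurable (B 0%N).
    by rewrite /B -[X in measurable X]setTI; exact: measurable_lte.
  by case: n => [//|n]; exact: measurableC.
have [|A AB] := cpartition_within mB (P := P).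
  near=> w; have [Bw|Bw] := pselect (B 0%N w); first by exists 0%N.
  by exists 1%N.
(* Up to a negligible set, [A 0] is the event where the inequality fails. *)
pose v n := if n is 0 then x else z.
have := rm_glueP hE A v; have := hfs v A.
set y := rm_glue hE A v => fy vy.
have fyE := eL0_glueE A (fun n => f (v n)); rewrite -fy in fyE.
have dE := rm_dist_glued z vy.
have gE : {ae P, forall w, g w = f z w - (b w)%:E}%E.
  near=> w; rewrite (near (eL0_DE (f z) (eL0_of (- b))) w)//.
  by rewrite (near (eL0_ofE (- b)) w)// (near (L0_NE b) w).
have bE := L0_ME alpha (rm_dist x z).
have b0 : {ae P, forall w, 0 <= b w}.
  have /L0_leP h := alpha_dist_ge0 x z.
  by apply: filterS2 h (L0_0E P) => w /[swap] ->.
have yz : y = z.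
  apply: zmin; rewrite /descends eL0_leBrDr rm_distC; apply/eL0_leP.
  set c : L0 P := alpha * rm_dist y z.
  have cE := L0_ME alpha (rm_dist y z); have NE := L0_NE c.
  have oE := eL0_ofE (- c); have hE' := eL0_DE (f z) (eL0_of (- c)).
  have zz : {ae P, forall w, rm_dist z z w = 0}.
    by rewrite (proj2 (rm_dist_eq0 z z))//; exact: L0_0E.
  near=> w; have [n Anw] := cpart_index A w.
  have Bnw : B n w by apply: (near AB w).
  rewrite (near fyE w _ n)// (near hE' w)// (near oE w)// (near NE w)//.
  rewrite (near cE w)// (near dE w _ n)//.
  case: n Anw Bnw => [|n] _ /=; last by rewrite (near zz w)// mulr0 oppr0 adde0.
  by rewrite (near gE w)// (near bE w)// => /ltW.
have fyz : {ae P, forall w, f y w = f z w} by rewrite yz; exact: aeW.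
apply/eL0_leP; near=> w; have [n Anw] := cpart_index A w.
have Bnw : B n w by apply: (near AB w).
have fyw : f y w = f (v n) w by apply: (near fyE w).
case: n Bnw fyw {Anw} => [|n] /=; last by move=> /negP; rewrite -leNgt.
rewrite (near fyz w)// => + fzx; rewrite -fzx (near gE w)// ltNge => /negP[].
by rewrite geeDl// lee_fin oppr_le0 (near b0 w).
Unshelve. all: by end_near. Qed.

End ekeland.

(** * The variational principle *)

Theorem theorem3p7 (d : measure_display) (Omega : measurableType d)
    (R : realType) (P : probability Omega R)
    (E : rmSpace P) (hE : rm_sigma_stable E) (hEc : rm_complete E)
    (eps : L0 P) (heps : L0pp P eps)
    (f : E -> eL0 P) (hfp : eL0_proper f) (hfs : eL0_sigma_stable f hE)
    (hfl : eL0_lsc f) (hfb : eL0_bounded_below f)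
    (x0 : E) (hx0 : f x0 <= eL0_inf (range f) + eL0_of eps)
    (alpha : L0 P) (halpha : L0pp P alpha) :
  exists z : E,
    [/\ f z <= f x0 + eL0_of (- (alpha * rm_dist z x0)),
        rm_dist z x0 <= L0_inv alpha * eps &
        forall x : E, x <> z ->
          f z + eL0_of (- (alpha * rm_dist x z)) <= f x /\
          f x <> f z + eL0_of (- (alpha * rm_dist x z))].
Proof.
have infle x : eL0_inf (range f) <= f x by apply: eL0_inf_le; exists x.
have x0fin : {ae P, forall w, f x0 w < +oo}%E.
  have [_ [x xfin]] := hfp.
  have /eL0_leP h := le_trans hx0 (eL0_leD (infle x) (lexx _)).
  have DE := eL0_DE (f x) (eL0_of eps); have oE := eL0_ofE eps.
  near=> w; apply: (le_lt_trans (near h w _)) => //.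
  by rewrite (near DE w)// (near oE w)// lte_add_pinfty ?ltry// (near xfin w).
have [z x0z zmin] :=
  exists_descends_minimal halpha hEc hfs hfl hfb x0fin.
exists z; split.
- by rewrite -eL0_leBrDr rm_distC.
- have [eta etaf] := hfb.
  have [a fza] : exists a, f z = eL0_of a.
    by apply: eL0_of_sandwich (etaf z) (descends_le halpha x0z) x0fin.
  have := le_trans x0z (le_trans hx0 (eL0_leD (infle z) (lexx _))).
  rewrite fza -!eL0_ofD eL0_of_le => h.
  rewrite -(@L0_ler_pM2l _ _ _ P alpha)// L0_mulKl// rm_distC.
  by rewrite -(addKr a (_ * _)) -(addKr a eps) L0_lerD.
- by move=> x xz; exact: minimal_strict.
Unshelve. all: by end_near. Qed.
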